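(* Let $a,b\ge1$ be coprime integers with $a\le b$, and write $$P_{a/b}(u,v,w)=\sum_{k\ge0}S_k(v,w)\,u^k=\sum_{k\ge0}R_k(u,w)\,v^k=\sum_{k\ge0}T_k(u,v)\,w^k$$ with polynomials $S_k,R_k,T_k$. Then: (1) $S_0(v,w)=v^b(v+w)^{a-1}$; (2) $R_0(u,w)=u^a(u+w)^{b-1}$; (3) if $b\ge 3$, $R_1(u,w)=(3a-1)\,u^a(u+w)^{b-2}+(b-2a)\,u^{a+1}(u+w)^{b-3}$; (4) $T_0(u,v)=(u+v)^{a+b-1}$; (5) if $a+b\ge 3$, $T_1(u,v)=(a-1)(u+v)^{a+b-2}+(b-a)\,u\,(u+v)^{a+b-3}$; (6) if $a+b\ge5$, $T_2(u,v)=\frac{(a-1)(a-2)}{2}(u+v)^{a+b-3}+\big[a(b-a)-a\big]u(u+v)^{a+b-4}+\frac12\big[(b-a)^2+5a-3b\big]u^2(u+v)^{a+b-5}$.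
   Context: Markov polynomials. Let $x,y,z$ be indeterminates. Consider the set consisting of all rationals $\rho\in[0,1]$, each written in lowest terms $\rho=a/b$ with integers $a\ge 0$, $b\ge 1$, together with the formal symbol $1/0$. Define Laurent polynomials $M_\rho(x,y,z)$ recursively by $M_{1/0}=y$, $M_{0/1}=x$, $M_{1/1}=\frac{x^2+y^2}{z}$, and: whenever $a/b$, $c/d$ are in this set with $|ad-bc|=1$ and $(a+2c)/(b+2d)\in[0,1]$, then $M_{\frac{a+2c}{b+2d}}=\big(M_{c/d}^2+M_{\frac{a+c}{b+d}}^2\big)/M_{a/b}$. This determines $M_\rho$ for every rational $\rho\in[0,1]$. Numerator. For coprime $1\le a\le b$, $P_{a/b}(u,v,w)$ denotes the homogeneous polynomial of degree $a+b-1$ such that $M_{a/b}(x,y,z)=P_{a/b}(x^2,y^2,z^2)/(x^{a-1}y^{b-1}z^{a+b-1})$; its existence is known. *)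

(* Defs.v *)
From HB Require Import structures.
From mathcomp Require Import all_boot all_order all_algebra.
From mathcomp Require Import fraction.
From mathcomp Require Import mpoly.

Set Implicit Arguments.
Unset Strict Implicit.
Unset Printing Implicit Defensive.

Import Order.TTheory GRing.Theory Num.Theory.
Local Open Scope ring_scope.

Notation "x %:F" := (@FracField.tofrac _ x) : ring_scope.

Definition Pol3 := {mpoly rat[3]}.
Definition Pol2 := {mpoly rat[2]}.

Definition i0 : 'I_3 := @Ordinal 3 0 isT.
Definition i1 : 'I_3 := @Ordinal 3 1 isT.
Definition i2 : 'I_3 := @Ordinal 3 2 isT.
Definition j0 : 'I_2 := @Ordinal 2 0 isT.
Definition j1 : 'I_2 := @Ordinal 2 1 isT.

(* Laurent polynomials in x, y, z live in the field of rational functions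
   K = Frac(Q[x,y,z]); x, y, z are the images of the three variables. *)
Definition K := {fraction {mpoly rat[3]}}.
Definition xK : K := ('X_i0 : Pol3)%:F.
Definition yK : K := ('X_i1 : Pol3)%:F.
Definition zK : K := ('X_i2 : Pol3)%:F.

(* A pair (a, b) of naturals represents the rational a/b in lowest terms with
   a/b in [0,1], or the formal symbol 1/0 (the pair (1,0)). *)
Definition valid_idx (a b : nat) : bool :=
  coprime a b && ((a <= b)%N || (b == 0%N)).

(* M : nat -> nat -> K, with M a b standing for M_{a/b}, satisfies the
   defining recursion of the Markov polynomials. *)
Definition is_markov_family (M : nat -> nat -> K) : Prop :=
  [/\ M 1%N 0%N = yK,
      M 0%N 1%N = xK,
      M 1%N 1%N = (xK ^+ 2 + yK ^+ 2) / zK &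
      forall a b c d : nat,
        valid_idx a b -> valid_idx c d ->
        ((a * d == b * c + 1)%N || (b * c == a * d + 1)%N) ->
        (a + 2 * c <= b + 2 * d)%N ->
        M (a + 2 * c)%N (b + 2 * d)%N
        = (M c d ^+ 2 + M (a + c)%N (b + d)%N ^+ 2) / M a b].

Definition sq_subst (P : Pol3) : Pol3 :=
  P \mPo [tuple ('X_i0 : Pol3) ^+ 2; ('X_i1 : Pol3) ^+ 2; ('X_i2 : Pol3) ^+ 2].

Definition is_numerator (M : nat -> nat -> K) (a b : nat) (P : Pol3) : Prop :=
  P \is (a + b - 1)%N.-homog /\
  M a b = (sq_subst P)%:F
          / (xK ^+ (a - 1) * yK ^+ (b - 1) * zK ^+ (a + b - 1)).

Definition emb_vw (S : Pol2) : Pol3 := S \mPo [tuple ('X_i1 : Pol3); 'X_i2].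
Definition emb_uw (S : Pol2) : Pol3 := S \mPo [tuple ('X_i0 : Pol3); 'X_i2].
Definition emb_uv (S : Pol2) : Pol3 := S \mPo [tuple ('X_i0 : Pol3); 'X_i1].

(* Main.v *)
Require Import Defs.
From HB Require Import structures.
From mathcomp Require Import all_boot all_order all_algebra.
From mathcomp Require Import fraction.
From mathcomp Require Import mpoly ring zify.
Import Order.TTheory GRing.Theory Num.Theory.
Local Open Scope ring_scope.

(** The Vieta form of the recursion is
    [P_{p+2q} = (u+v+w) P_q P_{p+q} - W^q P_p] with [W^q] a monomial, which is
    the recursion of traces of words in two matrices.  Modulo a power of one
    of the variables the matrices behave as if they commuted: there are
    explicit power series [g, g', h, h'] in that variable such that
    [(u+v+w) P_{a/(a+e)} = g^a h^e + g'^a h'^e] to the required order, and the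
    primed term is of high order.  The low coefficients of [g^a h^e] then give
    those of [P].  Substituting [w := (u+v)^2 X] or [v := (u+w)^2 X]
    makes the series polynomial. *)

(** * The tree of polynomial triples *)

Local Notation u := ('X_i0 : Pol3).
Local Notation v := ('X_i1 : Pol3).
Local Notation w := ('X_i2 : Pol3).

Definition sigma : Pol3 := u + v + w.

(** The monomial [u^a v^(a+e) w^(2a+e)]. At [u = x^2], [v = y^2], [w = z^2] it is the square of
    [xyz] times the denominator of [M_{a/(a+e)}]. In trace terms it is a determinant, hence
    multiplicative in the index. *)
Definition wt (a e : nat) : Pol3 := (u * v * w ^+ 2) ^+ a * (v * w) ^+ e.

Lemma wtD a e c f : wt (a + c) (e + f) = wt a e * wt c f.
Proof. by rewrite /wt !exprD mulrACA. Qed.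

(* The index (a, e) stands for the fraction a/(a+e): in these coordinates the
   recursion runs over the whole Stern-Brocot tree between (0,1) and (1,0). *)
Inductive markov_triple :
    nat -> nat -> nat -> nat -> Pol3 -> Pol3 -> Pol3 -> Prop :=
| markov_root : markov_triple 0 1 1 0 1 (u + v) ((u + v) ^+ 2 + u * w)
| markov_left a e c f A B C : markov_triple a e c f A B C ->
    markov_triple a e (a + c) (e + f) A C (sigma * A * C - wt a e * B)
| markov_right a e c f A B C : markov_triple a e c f A B C ->
    markov_triple (a + c) (e + f) c f C B (sigma * B * C - wt c f * A).

Lemma markov_triple_det a e c f A B C :
  markov_triple a e c f A B C -> (c * e = a * f + 1)%N.
Proof. by elim=> // {}a {}e {}c {}f *; lia. Qed.

(** A Markov-type equation, invariant along the tree. Read as a quadratic in [B] (or [A]), it has as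
    second root, up to a monomial factor, the polynomial created by the left (or right) move. *)
Lemma markov_triple_eq a e c f A B C : markov_triple a e c f A B C ->
  A ^+ 2 * wt c f + B ^+ 2 * wt a e + C ^+ 2 = sigma * A * B * C.
Proof.
elim=> [|{}a {}e {}c {}f {}A {}B {}C _ IH|{}a {}e {}c {}f {}A {}B {}C _ IH].
- by rewrite /wt /sigma; ring.
- have -> : A ^+ 2 * wt (a + c) (e + f) = wt a e * (A ^+ 2 * wt c f).
    by rewrite wtD; ring.
  have -> : A ^+ 2 * wt c f = sigma * A * B * C - B ^+ 2 * wt a e - C ^+ 2.
    by rewrite -IH; ring.
  by move: (wt a e) => W; ring.
- have -> : B ^+ 2 * wt (a + c) (e + f) = wt c f * (B ^+ 2 * wt a e).
    by rewrite wtD; ring.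
  have -> : B ^+ 2 * wt a e = sigma * A * B * C - A ^+ 2 * wt c f - C ^+ 2.
    by rewrite -IH; ring.
  by move: (wt c f) => W; ring.
Qed.

(** Subtractive Euclid on [(k, l)], the coordinates of the target index in the basis [(a, e)],
    [(c, f)]: a right move replaces [l] by [l - k], a left move replaces [k] by [k - l]. At
    [k = l = 1] the target is the index of [C]. *)
Lemma markov_triple_reach k l a e c f A B C :
  (0 < k)%N -> (0 < l)%N -> coprime k l -> markov_triple a e c f A B C ->
  exists p r q s A' B' C', [/\ markov_triple p r q s A' B' C',
    (p + q = k * a + l * c)%N & (r + s = k * e + l * f)%N].
Proof.
have [n] := ubnP (k + l)%N.
elim: n k l a e c f A B C => // n IH k l a e c f A B C lt_n k0 l0 cokl tr.
case: (ltngtP k l) => [ltkl|ltlk|eqkl].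
- have El : l = (k + (l - k))%N by lia.
  have cokl' : coprime k (l - k) by move: cokl; rewrite {1}El /coprime gcdnDl.
  have [||p [r [q [s [A' [B' [C' [tr' Ea Ee]]]]]]]] :=
    IH _ _ _ _ _ _ _ _ _ _ k0 _ cokl' (markov_right _ _ _ _ _ _ _ tr); try lia.
  by exists p, r, q, s, A', B', C'; split=> //; nia.
- have El : k = (l + (k - l))%N by lia.
  have cokl' : coprime (k - l) l 
    by move: cokl; rewrite {1}El coprime_sym /coprime gcdnDl gcdnC.
  have [||p [r [q [s [A' [B' [C' [tr' Ea Ee]]]]]]]] :=
    IH _ _ _ _ _ _ _ _ _ _ _ l0 cokl' (markov_left _ _ _ _ _ _ _ tr); try lia.
  by exists p, r, q, s, A', B', C'; split=> //; nia.
- move: cokl; rewrite eqkl /coprime gcdnn => /eqP ->.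
  by exists a, e, c, f, A, B, C; split=> //; lia.
Qed.

Lemma markov_triple_exists a b : (1 <= a)%N -> (a <= b)%N -> coprime a b ->
  exists c f A B C, markov_triple c f a (b - a) A B C.
Proof.
move=> a0 ab coab; have Eb : b = (a + (b - a))%N by lia.
have co : coprime a (b - a) by move: coab; rewrite {1}Eb /coprime gcdnDl.
case: (posnP (b - a)) co => [->|e0]; rewrite coprime_sym => co.
  move: co; rewrite /coprime gcd0n => /eqP ->.
  by do 5!eexists; apply: markov_root.
have [p [r [q [s [A [B [C [tr Ea Ee]]]]]]]] :=
  markov_triple_reach _ _ _ _ _ _ _ _ _ e0 a0 co markov_root.
(* The target index belongs to the third entry; one more left move brings it to the second. *)
have /markov_left := tr; rewrite Ea Ee !muln0 !muln1 add0n addn0 => tr'.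
by do 5!eexists; apply: tr'.
Qed.

(** * From Markov families in [K] to polynomial triples *)

Lemma mpolyX_neq0 (m : 'X_{1..3}) : 'X_[m] != 0 :> Pol3.
Proof. by rewrite -msupp_eq0 msuppX. Qed.

(** Squaring the variables doubles every exponent, so no two monomials collide and the coefficient
    at [m] reappears at [m + m]. *)
Lemma sq_subst_inj : injective sq_subst.
Proof.
have coefE (p : Pol3) (m : 'X_{1..3}) : (sq_subst p)@_(m + m) = p@_m.
  have monE (k : 'X_{1..3}) :
      'X_[k] \mPo [tuple u ^+ 2; v ^+ 2; w ^+ 2] = 'X_[k + k] :> Pol3.
    rewrite comp_mpolyX mpolyXD (mpolyXE_id _ k) -big_split /=.
    apply: eq_bigr => i _; rewrite -exprMn -expr2 (tnth_nth 0).
    by case: i => [[|[|[|]]] //= lti]; congr ((_ ^+ 2) ^+ _); congr ('X_[U_(_)]);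
      apply: val_inj.
  have -> : sq_subst p = \sum_(k <- msupp p) p@_k *: 'X_[k + k].
    by rewrite /sq_subst comp_mpolyEX; apply: eq_bigr => k _; rewrite monE.
  rewrite [p in RHS]mpolyE !(raddf_sum (mcoeff _)).
  apply: eq_bigr => k _; rewrite /= !mcoeffZ !mcoeffX.
  congr (_ * (nat_of_bool _)%:R); apply/eqP/eqP => [/mnmP eq|-> //].
  by apply/mnmP => i; have := eq i; rewrite !mnmDE !addnn => /double_inj.
by move=> p q eq; apply/mpolyP => m; rewrite -[LHS]coefE eq coefE.
Qed.

Definition sqF (P : Pol3) : K := (sq_subst P)%:F.

HB.instance Definition _ := GRing.RMorphism.copy sqF
  (@FracField.tofrac _ \o comp_mpoly [tuple u ^+ 2; v ^+ 2; w ^+ 2]).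

Lemma sqFD : {morph sqF : P Q / P + Q}. Proof. exact: rmorphD. Qed.
Lemma sqFM : {morph sqF : P Q / P * Q}. Proof. exact: rmorphM. Qed.
Lemma sqFX n : {morph sqF : P / P ^+ n}. Proof. exact: rmorphXn. Qed.

Lemma sqFu : sqF u = xK ^+ 2.
Proof. by rewrite /sqF /sq_subst comp_mpolyXU rmorphXn. Qed.

Lemma sqFv : sqF v = yK ^+ 2.
Proof. by rewrite /sqF /sq_subst comp_mpolyXU rmorphXn. Qed.

Lemma sqFw : sqF w = zK ^+ 2.
Proof. by rewrite /sqF /sq_subst comp_mpolyXU rmorphXn. Qed.

(** The extra factor [xyz] relative to the denominator of [M_{a/(a+e)}] makes this multiplicative in
    the index; [markov_val] compensates for it. *)
Definition markov_den (a e : nat) : K :=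
  xK ^+ a * yK ^+ (a + e) * zK ^+ (2 * a + e).

Definition markov_val (a e : nat) (A : Pol3) : K :=
  xK * yK * zK * sqF A / markov_den a e.

Lemma xK_neq0 : xK != 0. Proof. by rewrite tofrac_eq0 mpolyX_neq0. Qed.
Lemma yK_neq0 : yK != 0. Proof. by rewrite tofrac_eq0 mpolyX_neq0. Qed.
Lemma zK_neq0 : zK != 0. Proof. by rewrite tofrac_eq0 mpolyX_neq0. Qed.

Lemma markov_denD a e c f :
  markov_den (a + c) (e + f) = markov_den a e * markov_den c f.
Proof.
rewrite /markov_den mulrACA [X in _ = X * _]mulrACA -!exprD.
by congr (_ * _ ^+ _ * _ ^+ _); lia.
Qed.

Lemma markov_den_neq0 a e : markov_den a e != 0.
Proof.
apply: mulf_neq0; last exact: expf_neq0 zK_neq0.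
by apply: mulf_neq0; apply: expf_neq0; [exact: xK_neq0 | exact: yK_neq0].
Qed.

Lemma sqF_wt a e : sqF (wt a e) = markov_den a e ^+ 2.
Proof.
rewrite /wt /markov_den !(rmorphM, rmorphXn) /= sqFu sqFv sqFw.
rewrite (exprD zK) mulnC exprM exprD !exprMn.
by move: (xK ^+ a) (yK ^+ a) (zK ^+ a) (yK ^+ e) (zK ^+ e) => *; ring.
Qed.

Lemma markov_vieta_left a e c f A B C : markov_triple a e c f A B C ->
  B * (sigma * A * C - wt a e * B) = A ^+ 2 * wt c f + C ^+ 2.
Proof.
move/markov_triple_eq; move: (wt a e) (wt c f) sigma => W W' s E.
have -> : B * (s * A * C - W * B) = s * A * B * C - B ^+ 2 * W by ring.
by rewrite -E; ring.
Qed.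

Lemma markov_vieta_right a e c f A B C : markov_triple a e c f A B C ->
  A * (sigma * B * C - wt c f * A) = B ^+ 2 * wt a e + C ^+ 2.
Proof.
move/markov_triple_eq; move: (wt a e) (wt c f) sigma => W W' s E.
have -> : A * (s * B * C - W' * A) = s * A * B * C - A ^+ 2 * W' by ring.
by rewrite -E; ring.
Qed.

(** Evaluation at [(0, 1, 0)], where [sigma] is 1 and the weights occurring in the moves vanish.
    Every polynomial of the tree then takes the value 1, so the recursion never divides by zero. *)
Definition eval_v (P : Pol3) : rat := P.@[fun i => (i == i1)%:R].

HB.instance Definition _ :=
  GRing.RMorphism.copy eval_v (meval (fun i : 'I_3 => (i == i1)%:R : rat)).

Lemma eval_v_wt a e : (0 < a + e)%N -> eval_v (wt a e) = 0.
Proof.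
rewrite /wt rmorphM !rmorphXn !rmorphM /= /eval_v !mevalXU /=.
rewrite !mul0r mulr0 !expr0n.
by case: a e => [|a] [|e].
Qed.

Lemma eval_v_markov_triple a e c f A B C : markov_triple a e c f A B C ->
  [/\ eval_v A = 1, eval_v B = 1 & eval_v C = 1].
Proof.
have eval_sigma : eval_v sigma = 1.
  by rewrite /sigma !rmorphD /= /eval_v !mevalXU /= add0r addr0.
have step X Y Z W : eval_v X = 1 -> eval_v Y = 1 -> eval_v W = 0 ->
    eval_v (sigma * X * Y - W * Z) = 1.
  by move=> EX EY EW; rewrite rmorphB !rmorphM /= EX EY EW eval_sigma; ring.
elim=> [|{}a {}e {}c {}f {}A {}B {}C tr [EA EB EC]
        |{}a {}e {}c {}f {}A {}B {}C tr [EA EB EC]].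
- rewrite !(rmorph1, rmorphD, rmorphXn, rmorphM) /= /eval_v !mevalXU /=.
  by split=> //; rewrite add0r ?mul0r ?expr1n ?addr0.
- have /markov_triple_det det := tr; split=> //.
  by apply: step => //; apply: eval_v_wt; nia.
- have /markov_triple_det det := tr; split=> //.
  by apply: step => //; apply: eval_v_wt; nia.
Qed.

Lemma eval_v_sqF P : eval_v P = 1 -> sqF P != 0.
Proof.
move=> E; rewrite tofrac_eq0; apply/eqP => sqP0; move: E.
have -> : P = 0 by apply: sq_subst_inj; rewrite sqP0 /sq_subst comp_mpoly0.
by rewrite rmorph0.
Qed.

Lemma coprime_det a e c f : (c * e = a * f + 1)%N -> coprime a e /\ coprime c f.
Proof.
move=> det; split; rewrite /coprime -dvdn1.
  rewrite -(dvdn_addr (m := a * f)) ?dvdn_mulr ?dvdn_gcdl //.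
  by rewrite -det dvdn_mull ?dvdn_gcdr.
rewrite -(dvdn_addr (m := a * f)) ?dvdn_mull ?dvdn_gcdr //.
by rewrite -det dvdn_mulr ?dvdn_gcdl.
Qed.

Lemma coprime_valid_idx a e : coprime a e -> valid_idx a (a + e).
Proof. by move=> co; rewrite /valid_idx /coprime gcdnDl leq_addr andbT. Qed.

(* [k = xyz] and [p], [q] are the monomial denominators of the entries
   [A], [B] of a triple. *)
Lemma vieta_frac (F : fieldType) (k p q A B C D : F) :
  k != 0 -> p != 0 -> q != 0 -> B != 0 ->
  B * D = A ^+ 2 * q ^+ 2 + C ^+ 2 ->
  k * D / (p * (p * q)) =
    ((k * A / p) ^+ 2 + (k * C / (p * q)) ^+ 2) / (k * B / q).
Proof.
move=> k0 p0 q0 B0 E.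
have -> : D = (A ^+ 2 * q ^+ 2 + C ^+ 2) / B.
  by rewrite -E mulrC mulrA mulVf ?mul1r.
by field; rewrite k0 p0 q0 B0.
Qed.

Lemma markov_val_vieta a e c f A B C D : sqF B != 0 ->
  B * D = A ^+ 2 * wt c f + C ^+ 2 ->
  markov_val (a + (a + c)) (e + (e + f)) D =
    (markov_val a e A ^+ 2 + markov_val (a + c) (e + f) C ^+ 2)
      / markov_val c f B.
Proof.
move=> B0 /(congr1 sqF).
rewrite sqFD (sqFM B D) (sqFM (A ^+ 2) (wt c f)) sqF_wt !sqFX.
rewrite /markov_val !markov_denD.
have k0 : xK * yK * zK != 0 := mulf_neq0 (mulf_neq0 xK_neq0 yK_neq0) zK_neq0.
move: k0 (markov_den_neq0 a e) (markov_den_neq0 c f) B0.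
move: (xK * yK * zK) (markov_den a e) (markov_den c f).
move: (sqF A) (sqF B) (sqF C) (sqF D) => x y z t k p q k0 p0 q0 y0 E.
exact: vieta_frac k0 p0 q0 y0 E.
Qed.

Lemma markov_root_frac (F : fieldType) (x y z : F) :
  x != 0 -> y != 0 -> z != 0 ->
  [/\ x = x * y * z * 1 / (x ^+ 0 * y ^+ 1 * z ^+ 1),
      (x ^+ 2 + y ^+ 2) / z =
        x * y * z * (x ^+ 2 + y ^+ 2) / (x ^+ 1 * y ^+ 1 * z ^+ 2)
    & (x ^+ 2 + ((x ^+ 2 + y ^+ 2) / z) ^+ 2) / y =
        x * y * z * ((x ^+ 2 + y ^+ 2) ^+ 2 + x ^+ 2 * z ^+ 2)
          / (x ^+ 1 * y ^+ 2 * z ^+ 3)].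
Proof.
by move=> x0 y0 z0; split; field; rewrite ?x0 ?y0 ?z0.
Qed.

Lemma markov_family_triple M a e c f A B C : is_markov_family M ->
  markov_triple a e c f A B C ->
  [/\ M a (a + e)%N = markov_val a e A, M c (c + f)%N = markov_val c f B
    & M (a + c)%N (a + c + (e + f))%N = markov_val (a + c) (e + f) C].
Proof.
move=> [M10 M01 M11 Mrec].
elim=> [|{}a {}e {}c {}f {}A {}B {}C tr [EA EB EC]
        |{}a {}e {}c {}f {}A {}B {}C tr [EA EB EC]].
(* The third root value is [M_{1/2}], from the recursion at [1/0] and [0/1]. *)
- rewrite M01 M11 (Mrec 1 0 0 1)%N // M01 M11 M10.
  rewrite /markov_val /markov_den !(rmorph1, rmorphD, rmorphXn, rmorphM) /=.
  rewrite sqFu sqFv sqFw.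
  exact: markov_root_frac xK_neq0 yK_neq0 zK_neq0.
- have /markov_triple_det det := tr.
  have [coae cocf] := coprime_det _ _ _ _ det.
  have [_ EvB _] := eval_v_markov_triple _ _ _ _ _ _ _ tr.
  split=> //.
  (* The left move is the recursion that divides by the value at [c/(c+f)] and doubles the index
     [a/(a+e)]; the right move exchanges the two. *)
  have -> : (a + (a + c) = c + 2 * a)%N by lia.
  have -> : (c + 2 * a + (e + (e + f)) = c + f + 2 * (a + e))%N by lia.
  rewrite Mrec ?coprime_valid_idx //; [|nia|nia].
  have -> : (c + f + (a + e) = a + c + (e + f))%N by lia.
  rewrite EA EB addnC EC /markov_val.
  have -> : (c + 2 * a = a + (a + c))%N by lia.
  apply/esym/markov_val_vieta; first exact: eval_v_sqF.
  exact: markov_vieta_left tr.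
- have /markov_triple_det det := tr.
  have [coae cocf] := coprime_det _ _ _ _ det.
  have [EvA _ _] := eval_v_markov_triple _ _ _ _ _ _ _ tr.
  split=> //.
  have -> : (a + c + c = a + 2 * c)%N by lia.
  have -> : (a + 2 * c + (e + f + f) = a + e + 2 * (c + f))%N by lia.
  rewrite Mrec ?coprime_valid_idx //; [|nia|nia].
  have -> : (a + e + (c + f) = a + c + (e + f))%N by lia.
  rewrite EA EB EC /markov_val.
  have -> : (a + 2 * c = c + (c + a))%N by lia.
  rewrite [(e + f + f)%N]addnC [(a + c)%N]addnC [(e + f)%N]addnC.
  apply/esym/markov_val_vieta; first exact: eval_v_sqF.
  exact: markov_vieta_right tr.
Qed.


Lemma numerator_frac (F : fieldType) (x y z p q : F) (a b c : nat) :
  x != 0 -> y != 0 -> z != 0 ->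
  p / (x ^+ a * y ^+ b * z ^+ c) =
    x * y * z * q / (x ^+ a.+1 * y ^+ b.+1 * z ^+ c.+1) -> p = q.
Proof.
move=> x0 y0 z0; rewrite !exprS => E.
have [xa yb zc] : [/\ x ^+ a != 0, y ^+ b != 0 & z ^+ c != 0].
  by split; apply: expf_neq0.
move: (x ^+ a) (y ^+ b) (z ^+ c) xa yb zc E => X Y Z X0 Y0 Z0 E.
have -> : p = p / (X * Y * Z) * (X * Y * Z).
  by rewrite divfK // !mulf_neq0.
by rewrite E; field; rewrite x0 y0 z0 X0 Y0 Z0.
Qed.

(** Both [P] and the tree polynomial of index [(a, b - a)] represent [M a b] over the same monomial,
    and [sq_subst] is injective. The rest of the proof thus concerns tree polynomials only. *)
Lemma numerator_unique M a b P : (1 <= a)%N -> (a <= b)%N -> coprime a b ->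
  is_markov_family M -> is_numerator M a b P ->
  exists c f A C, markov_triple c f a (b - a) A P C.
Proof.
move=> a0 ab co fam [_ EM].
have [c [f [A [B [C tr]]]]] := markov_triple_exists _ _ a0 ab co.
exists c, f, A, C; suff <- : B = P by [].
have [_ EB _] := markov_family_triple _ _ _ _ _ _ _ _ fam tr.
have b0 := leq_trans a0 ab.
move: EB; rewrite subnKC // EM /markov_val /markov_den subnKC //.
have -> : (2 * a + (b - a) = (a + b - 1).+1)%N by lia.
have [Ea Eb] : (a = (a - 1).+1 /\ b = (b - 1).+1)%N by lia.
rewrite [in X in xK ^+ X * yK ^+ _ * zK ^+ _.+1]Ea.
rewrite [in X in xK ^+ _ * yK ^+ X * zK ^+ _.+1]Eb => E.
apply/esym/sq_subst_inj/eqP; rewrite -tofrac_eq; apply/eqP.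
exact: numerator_frac xK_neq0 yK_neq0 zK_neq0 E.
Qed.

(** * Congruences and traces of commuting matrices *)

Definition eqmod {R : comNzRingType} (t p q : R) := exists r, p = q + r * t.

Lemma eqmodM (R : comNzRingType) (t p q p' q' : R) :
  eqmod t p q -> eqmod t p' q' -> eqmod t (p * p') (q * q').
Proof.
move=> [r ->] [r' ->]; exists (q * r' + r * q' + r * r' * t); ring.
Qed.

Lemma eqmodB (R : comNzRingType) (t p q p' q' : R) :
  eqmod t p q -> eqmod t p' q' -> eqmod t (p - p') (q - q').
Proof. by move=> [r ->] [r' ->]; exists (r - r'); ring. Qed.

Lemma eqmodX (R : comNzRingType) (t p q : R) n :
  eqmod t p q -> eqmod t (p ^+ n) (q ^+ n).
Proof.
move=> E; elim: n => [|n IH]; first by exists 0; rewrite !expr0; ring.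
by rewrite !exprS; apply: eqmodM.
Qed.

Lemma eqmod_coef (R : comNzRingType) n i (p q : {poly R}) :
  eqmod 'X^n p q -> (i < n)%N -> p`_i = q`_i.
Proof. by move=> [r ->] lt_in; rewrite coefD coefMXn lt_in addr0. Qed.

Section Characters.
Variables (R : comNzRingType) (t g g' h h' : R) (phi : {rmorphism Pol3 -> R}).

(** The trace of [G^a H^e] for [G = diag(g, g')] and [H = diag(h, h')]. *)
Definition char_sum (a e : nat) : R := g ^+ a * h ^+ e + g' ^+ a * h' ^+ e.

(** This is [tr X tr(XY) - det X tr Y = tr(X^2 Y)] for commuting 2 by 2 matrices. *)
Lemma char_sumS a e c f :
  char_sum a e * char_sum (a + c) (e + f)
    - (g * g') ^+ a * (h * h') ^+ e * char_sum c f =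
  char_sum (a + (a + c)) (e + (e + f)).
Proof.
rewrite /char_sum !exprMn !exprD.
move: (g ^+ a) (g' ^+ a) (h ^+ e) (h' ^+ e) => *; ring.
Qed.

(* Modulo [t] the values [sigma * P] behave like traces of commuting
   matrices with eigenvalues [(g, g')] and [(h, h')]. *)
Lemma markov_triple_char a e c f A B C :
  eqmod t (phi sigma) (h + h') ->
  eqmod t (phi (sigma * (u + v))) (g + g') ->
  eqmod t (phi (sigma * ((u + v) ^+ 2 + u * w))) (g * h + g' * h') ->
  eqmod t (phi (v * w)) (h * h') ->
  eqmod t (phi (u * v * w ^+ 2)) (g * g') ->
  markov_triple a e c f A B C ->
  [/\ eqmod t (phi (sigma * A)) (char_sum a e),
      eqmod t (phi (sigma * B)) (char_sum c f)
    & eqmod t (phi (sigma * C)) (char_sum (a + c) (e + f))].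
Proof.
move=> E01 E10 E11 Evw Euvw.
have phi_wt i j : eqmod t (phi (wt i j)) ((g * g') ^+ i * (h * h') ^+ j).
  rewrite /wt (rmorphM phi (_ ^+ i)) !(rmorphXn phi).
  by apply: eqmodM; apply: eqmodX.
(* Multiplied by [sigma], the Vieta move becomes the trace identity [char_sumS]. *)
have step i j k l X Y Z : eqmod t (phi (sigma * X)) (char_sum i j) ->
    eqmod t (phi (sigma * Z)) (char_sum (i + k) (j + l)) ->
    eqmod t (phi (sigma * Y)) (char_sum k l) ->
    eqmod t (phi (sigma * (sigma * X * Z - wt i j * Y)))
      (char_sum (i + (i + k)) (j + (j + l))).
  move=> EX EZ EY; rewrite -char_sumS.
  have -> : sigma * (sigma * X * Z - wt i j * Y) =
      (sigma * X) * (sigma * Z) - wt i j * (sigma * Y).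
    by move: sigma (wt i j) => s W; ring.
  rewrite (rmorphB phi) (rmorphM phi (sigma * X)) (rmorphM phi (wt i j)).
  by apply: eqmodB; apply: eqmodM.
elim=> [|{}a {}e {}c {}f {}A {}B {}C _ [EA EB EC]
        |{}a {}e {}c {}f {}A {}B {}C _ [EA EB EC]].
- by rewrite /char_sum !expr0 !expr1 !mulr1 !mul1r.
- by split=> //; apply: step.
- split=> //; rewrite [(a + c + c)%N]addnC [(e + f + f)%N]addnC.
  rewrite [(a + c)%N]addnC [(e + f)%N]addnC.
  by apply: step; rewrite // [(c + a)%N]addnC [(f + e)%N]addnC.
Qed.

End Characters.

(** * Substitution into polynomials in one variable over [Pol2] *)

Section Substitution.
Variables p q r : {poly Pol2}.

Definition poly_subst (P : Pol3) : {poly Pol2} :=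
  mmap (polyC \o @mpolyC 2 rat) (tnth [tuple p; q; r]) P.

HB.instance Definition _ := GRing.RMorphism.copy poly_subst
  (mmap (polyC \o @mpolyC 2 rat) (tnth [tuple p; q; r])).

Lemma poly_substC c : poly_subst c%:MP = (c%:MP)%:P.
Proof. by rewrite /poly_subst mmapC. Qed.

Lemma poly_substu : poly_subst u = p.
Proof. by rewrite /poly_subst mmapX mmap1U. Qed.

Lemma poly_substv : poly_subst v = q.
Proof. by rewrite /poly_subst mmapX mmap1U. Qed.

Lemma poly_substw : poly_subst w = r.
Proof. by rewrite /poly_subst mmapX mmap1U. Qed.

Lemma poly_subst_comp (x y : Pol3) (S : Pol2) :
  poly_subst x = ('X_j0)%:P -> poly_subst y = ('X_j1)%:P ->
  poly_subst (S \mPo [tuple x; y]) = S%:P.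
Proof.
move=> Ex Ey; rewrite comp_mpolyEX [S in RHS]mpolyE !rmorph_sum /=.
apply: eq_bigr => m _; rewrite -mul_mpolyC rmorphM /= poly_substC.
rewrite -mul_mpolyC polyCM; congr (_ * _).
rewrite comp_mpolyX mpolyXE_id !big_ord_recl !big_ord0 !mulr1 rmorphM !rmorphXn.
rewrite !(tnth_nth 0) /= Ex Ey rmorphM !rmorphXn /=.
by congr (('X_[U_(_)])%:P ^+ _ * ('X_[U_(_)])%:P ^+ _); apply: val_inj.
Qed.

(** The expanded variable [z] becomes [c X], so the coefficient of [z^i] is read off up to the
    factor [c^i]. *)
Lemma coef_poly_subst n (x y z : Pol3) (S : nat -> Pol2) (c : Pol2) i :
  poly_subst x = ('X_j0)%:P -> poly_subst y = ('X_j1)%:P ->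
  poly_subst z = c%:P * 'X -> (i < n)%N ->
  (poly_subst (\sum_(k < n) (S k \mPo [tuple x; y]) * z ^+ k))`_i = S i * c ^+ i.
Proof.
move=> Ex Ey Ez lt_in.
have -> : poly_subst (\sum_(k < n) (S k \mPo [tuple x; y]) * z ^+ k) =
    \poly_(k < n) (S k * c ^+ k).
  rewrite poly_def rmorph_sum; apply: eq_bigr => k _.
  rewrite rmorphM rmorphXn /= Ez poly_subst_comp // exprMn mulrA -rmorphXn.
  by rewrite -rmorphM /= mul_polyC.
by rewrite coef_poly lt_in.
Qed.

End Substitution.


(** The five congruences prescribe the traces of [H], [G], [GH] and the determinants of [H], [G];
    these determine all traces along the tree. *)
Lemma poly_subst_char p q r t g g' h h' a e c f A P C :
  eqmod t (p + q + r) (h + h') ->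
  eqmod t ((p + q + r) * (p + q)) (g + g') ->
  eqmod t ((p + q + r) * ((p + q) ^+ 2 + p * r)) (g * h + g' * h') ->
  eqmod t (q * r) (h * h') ->
  eqmod t (p * q * r ^+ 2) (g * g') ->
  markov_triple c f a e A P C ->
  eqmod t ((p + q + r) * poly_subst p q r P) (char_sum _ g g' h h' a e).
Proof.
have phiE := (poly_substu p q r, poly_substv p q r, poly_substw p q r).
have sigmaE : poly_subst p q r sigma = p + q + r.
  by rewrite /sigma !rmorphD /= !phiE.
move=> E01 E10 E11 Evw Euvw tr.
have [|||||_ E _] := markov_triple_char _ t g g' h h' (poly_subst p q r)
  _ _ _ _ _ _ _ _ _ _ _ _ tr.
- by rewrite /= sigmaE.
- by rewrite rmorphM /= sigmaE rmorphD /= !phiE.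
- by rewrite rmorphM /= sigmaE rmorphD rmorphXn rmorphD rmorphM /= !phiE.
- by rewrite rmorphM /= !phiE.
- by rewrite !rmorphM /= !phiE.
by move: E; rewrite rmorphM /= sigmaE.
Qed.

(** * Low coefficients of [g^a h^e] *)

Section Coefficients.
Variable S : comNzRingType.
Implicit Types (p q : {poly S}) (x y k : S).

Lemma coef1M p q : (p * q)`_1 = p`_0 * q`_1 + p`_1 * q`_0.
Proof. by rewrite coefM !big_ord_recl big_ord0 addr0. Qed.

Lemma coef2M p q : (p * q)`_2 = p`_0 * q`_2 + p`_1 * q`_1 + p`_2 * q`_0.
Proof. by rewrite coefM !big_ord_recl big_ord0 addr0 addrA. Qed.

(** Discards the primed term [g'^a h'^e] in low degrees. *)
Lemma coefXM_small p q m n i d e : (i < m * d + n * e)%N ->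
  ((p * 'X^m) ^+ d * (q * 'X^n) ^+ e)`_i = 0.
Proof.
by move=> lt_i; rewrite !exprMn mulrACA -!exprM -exprD coefMXn lt_i.
Qed.

Definition quad x y : {poly S} := 1 + x%:P * 'X + y%:P * 'X^2.

Lemma coef_quad x y :
  [/\ (quad x y)`_0 = 1, (quad x y)`_1 = x & (quad x y)`_2 = y].
Proof.
by split; rewrite /quad !coefD !coefCM coef1 coefX coefXn /=; ring.
Qed.

Lemma coef01_quadX x y n :
  (quad x y ^+ n)`_0 = 1 /\ (quad x y ^+ n)`_1 = n%:R * x.
Proof.
have [q0 q1 _] := coef_quad x y.
elim: n => [|n [IH0 IH1]]; first by rewrite expr0 !coef1 mul0r.
by rewrite exprS coef0M coef1M q0 q1 IH0 IH1 -natr1; split; ring.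
Qed.

(* [k] stands for one half. *)
Lemma coef2_quadX x y k n : k + k = 1 ->
  (quad x y ^+ n)`_2 = n%:R * y + n%:R * (n%:R - 1) * k * x ^+ 2.
Proof.
move=> k2; have [q0 q1 q2] := coef_quad x y.
elim: n => [|n IH]; first by rewrite expr0 coef1 /=; ring.
have [c0 c1] := coef01_quadX x y n.
rewrite exprS coef2M q0 q1 q2 IH c0 c1 -natr1; apply/eqP; rewrite -subr_eq0.
have -> : forall m : S,
    1 * (m * y + m * (m - 1) * k * x ^+ 2) + x * (m * x) + y * 1
    - ((m + 1) * y + (m + 1) * (m + 1 - 1) * k * x ^+ 2)
  = (1 - (k + k)) * (m * x ^+ 2) by move=> m; ring.
by rewrite k2 subrr mul0r.
Qed.

(** Here [x], [y] stand for [v], [w] and [X] for [u]; at [u = 0] one has [g' = 0], and [0 < a] kills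
    the primed term. *)
Lemma expand_u x y a e (R : {poly S}) : (0 < a)%N ->
  eqmod 'X^1 (('X + x%:P + y%:P) * R)
    (char_sum _ (x%:P * (x%:P + y%:P)) 0 x%:P y%:P a e) ->
  (x + y) * R`_0 = x ^+ (a + e) * (x + y) ^+ a.
Proof.
move=> a0 /eqmod_coef/(_ (ltnSn 0)).
rewrite /char_sum expr0n eqn0Ngt a0 mul0r addr0.
rewrite coef0M !coefD coefX !coefC add0r => ->.
rewrite -polyCD -!polyCM -!polyC_exp -polyCM coefC exprMn exprD /=.
by rewrite mulrAC.
Qed.

(** Here [x], [y] stand for [u], [w], and [v = s^2 X]. To first order in [X], [h, h'] are the roots
    of [T^2 - (u+v+w) T + vw] and [g, g'] those of [T^2 - (u+v+w)(u+v) T + uvw^2]. The primed term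
    has order [a + e]. *)
Lemma expand_v x y a e (R : {poly S}) : (0 < a)%N ->
  let s := x + y in
  eqmod 'X^2 ((x%:P + (s ^+ 2)%:P * 'X + y%:P) * R)
    (char_sum _ ((s * x)%:P * quad (3 * s - x) 0) ((s * y ^+ 2)%:P * 'X^1)
      (s%:P * quad x 0) ((s * y)%:P * 'X^1) a e) ->
  s * R`_0 = s ^+ (a + e) * x ^+ a /\
  ((2 <= a + e)%N -> s * R`_1 + s ^+ 2 * R`_0 =
    s ^+ (a + e) * x ^+ a * (a%:R * (3 * s - x) + e%:R * x)).
Proof.
move=> a0 s E.
have charE i : (i < a + e)%N ->
    (char_sum _ ((s * x)%:P * quad (3 * s - x) 0) ((s * y ^+ 2)%:P * 'X^1)
      (s%:P * quad x 0) ((s * y)%:P * 'X^1) a e)`_i =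
    s ^+ (a + e) * x ^+ a * (quad (3 * s - x) 0 ^+ a * quad x 0 ^+ e)`_i.
  move=> lt_i; rewrite /char_sum coefD coefXM_small ?mul1n // addr0.
  rewrite !exprMn mulrACA -!polyC_exp -polyCM coefCM exprMn exprD.
  by congr (_ * _); rewrite mulrAC.
have s0 : (x%:P + (s ^+ 2)%:P * 'X + y%:P)`_0 = s.
  by rewrite !coefD coefCM coefX !coefC /= mulr0 addr0.
have s1 : (x%:P + (s ^+ 2)%:P * 'X + y%:P)`_1 = s ^+ 2.
  by rewrite !coefD coefCM coefX !coefC /= mulr1 addr0 add0r.
have [g0 g1] := coef01_quadX (3 * s - x) 0 a.
have [h0 h1] := coef01_quadX x 0 e; split.
  have := eqmod_coef _ 2 0 _ _ E isT; rewrite charE; last lia.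
  by rewrite !coef0M s0 g0 h0 !mulr1.
move=> lt1; have := eqmod_coef _ 2 1 _ _ E isT; rewrite charE //.
by rewrite !coef1M s0 s1 g0 h0 g1 h1 => ->; ring.

Qed.

(** The same quadratics, solved to second order with [x], [y] for [u], [v] and [w = s^2 X]. Now [g']
    has order 2 and [h'] order 1, so the primed term starts at [X^N]. *)
Lemma expand_w x y k a e (R : {poly S}) : (0 < a)%N -> k + k = 1 ->
  let s := x + y in let N := (2 * a + e)%N in
  eqmod 'X^3 ((x%:P + y%:P + (s ^+ 2)%:P * 'X) * R)
    (char_sum _ ((s ^+ 2)%:P * quad s (- (x * y)))
      ((s ^+ 2 * x * y)%:P * 'X^2)
      (s%:P * quad x (x * y)) ((s%:P * (y%:P - (x * y)%:P * 'X)) * 'X^1) a e) ->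
  [/\ s * R`_0 = s ^+ N,
      (3 <= N)%N -> s * R`_1 + s ^+ 2 * R`_0 = s ^+ N * (a%:R * s + e%:R * x)
    & (5 <= N)%N -> s * R`_2 + s ^+ 2 * R`_1 =
      s ^+ N * (a%:R * (a%:R - 1) * k * s ^+ 2 - a%:R * x * y
        + a%:R * s * e%:R * x + e%:R * (e%:R - 1) * k * x ^+ 2 + e%:R * x * y)].
Proof.
move=> a0 k2 s N E.
have charE i : (i < N)%N ->
    (char_sum _ ((s ^+ 2)%:P * quad s (- (x * y)))
      ((s ^+ 2 * x * y)%:P * 'X^2)
      (s%:P * quad x (x * y)) ((s%:P * (y%:P - (x * y)%:P * 'X)) * 'X^1) a e)`_i =
    s ^+ N * (quad s (- (x * y)) ^+ a * quad x (x * y) ^+ e)`_i.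
  move=> lt_i; rewrite /char_sum coefD coefXM_small ?mul1n // addr0.
  by rewrite !exprMn mulrACA -!polyC_exp -polyCM coefCM -exprM -exprD.
have [g0 g1] := coef01_quadX s (- (x * y)) a.
have [h0 h1] := coef01_quadX x (x * y) e.
have g2 := coef2_quadX s (- (x * y)) k a k2.
have h2 := coef2_quadX x (x * y) k e k2.
have [s0 s1 s2] : [/\ (x%:P + y%:P + (s ^+ 2)%:P * 'X)`_0 = s,
    (x%:P + y%:P + (s ^+ 2)%:P * 'X)`_1 = s ^+ 2
  & (x%:P + y%:P + (s ^+ 2)%:P * 'X)`_2 = 0].
  by split; rewrite !coefD coefCM coefX !coefC /= ?mulr0 ?mulr1 ?addr0 ?add0r.
split.
- have := eqmod_coef _ 3 0 _ _ E isT; rewrite charE; last lia.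
  by rewrite !coef0M s0 g0 h0 !mulr1.
- move=> ltN; have := eqmod_coef _ 3 1 _ _ E isT; rewrite charE; last lia.
  by rewrite !coef1M s0 s1 g0 h0 g1 h1 => ->; ring.
move=> ltN; have := eqmod_coef _ 3 2 _ _ E isT; rewrite charE; last lia.
by rewrite !coef2M s0 s1 s2 g0 h0 g1 h1 g2 h2 mul0r addr0 => ->; ring.
Qed.

End Coefficients.

(** * The three expansions of the numerator *)

Section Expansion.
Variables (a e : nat) (A P C : Pol3) (c f : nat).
Hypotheses (tr : markov_triple c f a e A P C) (a0 : (0 < a)%N).

Local Notation x := ('X_j0 : Pol2).
Local Notation y := ('X_j1 : Pol2).



Lemma numerator_expand_u : let R := poly_subst 'X x%:P y%:P P in
  (x + y) * R`_0 = x ^+ (a + e) * (x + y) ^+ a.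
Proof.
apply: expand_u => //; rewrite expr1; apply: poly_subst_char tr.
all: move: x%:P y%:P 'X => X Y Z.
(* Here and in the next two lemmas the witness is the difference of the two sides divided by the
   modulus, a power of [X]; after generalization the indeterminate is called [Z]. *)
- by exists 1; ring.
- by exists (Z + X + Y + X); ring.
- by exists ((Z + X) ^+ 2 + Z * Y + (X + Y) * (Z + X + X + Y)); ring.
- by exists 0; ring.
- by exists (X * Y ^+ 2); ring.
Qed.

Lemma numerator_expand_v :
  let s := x + y in let R := poly_subst x%:P ((s ^+ 2)%:P * 'X) y%:P P in
  s * R`_0 = s ^+ (a + e) * x ^+ a /\
  ((2 <= a + e)%N -> s * R`_1 + s ^+ 2 * R`_0 =
    s ^+ (a + e) * x ^+ a * (a%:R * (3 * s - x) + e%:R * x)).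
Proof.
apply: expand_v => //; apply: poly_subst_char tr.
all: rewrite /quad ?expr1.
all: rewrite ?(polyCD, polyCM, polyCN, polyC_exp, polyC0, rmorph_nat).
all: move: x%:P y%:P 'X => X Y Z.
- by exists 0; ring.
- by exists ((X + Y) ^+ 4); ring.
- exists ((X + Y) ^+ 5 + 2 * X * (X + Y) ^+ 4 + (X + Y) ^+ 6 * Z
    - (X + Y) ^+ 2 * X ^+ 2 * (3 * (X + Y) - X) - (X + Y) ^+ 2 * Y ^+ 3).
  by ring.
- by exists (- (X + Y) ^+ 2 * X * Y); ring.
- by exists (- (X + Y) ^+ 2 * X * Y ^+ 2 * (3 * (X + Y) - X)); ring.
Qed.

Lemma numerator_expand_w k : k + k = 1 ->
  let s := x + y in let N := (2 * a + e)%N in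
  let R := poly_subst x%:P y%:P ((s ^+ 2)%:P * 'X) P in
  [/\ s * R`_0 = s ^+ N,
      (3 <= N)%N -> s * R`_1 + s ^+ 2 * R`_0 = s ^+ N * (a%:R * s + e%:R * x)
    & (5 <= N)%N -> s * R`_2 + s ^+ 2 * R`_1 =
      s ^+ N * (a%:R * (a%:R - 1) * k * s ^+ 2 - a%:R * x * y
        + a%:R * s * e%:R * x + e%:R * (e%:R - 1) * k * x ^+ 2 + e%:R * x * y)].
Proof.
move=> k2; apply: expand_w => //; apply: poly_subst_char tr.
all: rewrite /quad ?expr1.
all: rewrite ?(polyCD, polyCM, polyCN, polyC_exp, polyC0, rmorph_nat).
all: move: x%:P y%:P 'X => X Y Z.
- by exists 0; ring.
- by exists 0; ring.
- exists (- (X + Y) ^+ 3 * (2 * X * Y ^+ 2 - 2 * X ^+ 2 * Y ^+ 2 * Z)).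
  by ring.
- exists (- (X + Y) ^+ 2 * (X * Y ^+ 2 - X ^+ 2 * Y - X ^+ 2 * Y ^+ 2 * Z)).
  by ring.
- by exists (- (X + Y) ^+ 4 * X * Y * (X + Y - X * Y * Z)); ring.
Qed.

End Expansion.

(** * Solving for the coefficients *)

(** Eliminate [r0], then cancel [s^3]: one [s] comes from [u+v+w], and [s^2] from the scaling of
    [v]. *)
Lemma solve_v (S : idomainType) (s x a e r0 r1 c : S) n :
  s != 0 -> s * r0 = s ^+ n.+3 * c ->
  s * (r1 * s ^+ 2) + s ^+ 2 * r0 = s ^+ n.+3 * c * (a * (3 * s - x) + e * x) ->
  r1 = (3 * a - 1) * (c * s ^+ n.+1) + (e - a) * (c * x * s ^+ n).
Proof.
move=> s0 E0 E1; apply: (mulfI (expf_neq0 3 s0)).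
have -> : s ^+ 3 * r1 =
    s ^+ n.+3 * c * (a * (3 * s - x) + e * x) - s * (s ^+ n.+3 * c).
  by rewrite -E1 -E0; ring.
rewrite !exprS; move: (s ^+ n) => q; ring.
Qed.

Lemma solve_w1 (S : idomainType) (s x a e t0 t1 : S) n :
  s != 0 -> s * t0 = s ^+ n.+3 ->
  s * (t1 * s ^+ 2) + s ^+ 2 * t0 = s ^+ n.+3 * (a * s + e * x) ->
  t1 = (a - 1) * s ^+ n.+1 + e * (x * s ^+ n).
Proof.
move=> s0 E0 E1; apply: (mulfI (expf_neq0 3 s0)).
have -> : s ^+ 3 * t1 = s ^+ n.+3 * (a * s + e * x) - s * s ^+ n.+3.
  by rewrite -E1 -E0; ring.
rewrite !exprS; move: (s ^+ n) => q; ring.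
Qed.

Lemma solve_w2 (S : idomainType) (x y a e k t1 t2 : S) n :
  let s := x + y in
  s != 0 -> k + k = 1 -> t1 = (a - 1) * s ^+ n.+3 + e * (x * s ^+ n.+2) ->
  s * (t2 * (s ^+ 2) ^+ 2) + s ^+ 2 * (t1 * s ^+ 2) =
    s ^+ n.+4.+1 * (a * (a - 1) * k * s ^+ 2 - a * x * y
      + a * s * e * x + e * (e - 1) * k * x ^+ 2 + e * x * y) ->
  t2 = (a - 1) * (a - 2) * k * s ^+ n.+2 + (a * e - a) * (x * s ^+ n.+1)
    + (e ^+ 2 + 5 * a - 3 * (a + e)) * k * (x ^+ 2 * s ^+ n).
Proof.
move=> s s0 k2 E1 E2; apply: (mulfI (expf_neq0 5 s0)).
have -> : s ^+ 5 * t2 = s ^+ n.+4.+1 * (a * (a - 1) * k * s ^+ 2 - a * x * y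
      + a * s * e * x + e * (e - 1) * k * x ^+ 2 + e * x * y) - s ^+ 4 * t1.
  by rewrite -E2; ring.
rewrite E1 !exprS {E1 E2}; apply/eqP; rewrite -subr_eq0; apply/eqP.
(* The two sides agree only modulo [k + k = 1], so their difference is exhibited as a multiple of
   [k + k - 1]. *)
transitivity ((k + k - 1) * s ^+ 5 * s ^+ n
    * ((a - 1) * s ^+ 2 - (a - e) * x ^+ 2)).
  by move: (s ^+ n) => q; rewrite /s; ring.
by rewrite k2 subrr !mul0r.
Qed.


(** * Assembly of the six formulas *)

Lemma X0D1_neq0 : 'X_j0 + 'X_j1 != 0 :> Pol2.
Proof.
apply/eqP => /(congr1 (meval (fun=> 1))).
by rewrite mevalD !mevalXU meval0.
Qed.

(* Variables: u = 'X_i0, v = 'X_i1, w = 'X_i2 in Pol3.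
   S k, R k, T k are two-variable polynomials (first variable 'X_j0,
   second 'X_j1): S k in (v,w), R k in (u,w), T k in (u,v).
   Since deg P = a+b-1, all exponents are < a+b. *)
Theorem theorem4p1 (a b : nat) (M : nat -> nat -> K) (P : Pol3)
    (S R T : nat -> Pol2) :
  (1 <= a)%N -> (a <= b)%N -> coprime a b ->
  is_markov_family M ->
  is_numerator M a b P ->
  P = \sum_(k < a + b) emb_vw (S k) * ('X_i0 : Pol3) ^+ k ->
  P = \sum_(k < a + b) emb_uw (R k) * ('X_i1 : Pol3) ^+ k ->
  P = \sum_(k < a + b) emb_uv (T k) * ('X_i2 : Pol3) ^+ k ->
  let A : rat := a%:R in
  let B : rat := b%:R in
  (* (1) *)
      (S 0%N = ('X_j0 : Pol2) ^+ b * ('X_j0 + 'X_j1) ^+ (a - 1)) /\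
      (* (2) *)
      (R 0%N = ('X_j0 : Pol2) ^+ a * ('X_j0 + 'X_j1) ^+ (b - 1)) /\
      (* (3) *)
      ((3 <= b)%N ->
        R 1%N = (3 * A - 1) *: (('X_j0 : Pol2) ^+ a * ('X_j0 + 'X_j1) ^+ (b - 2))
                + (B - 2 * A) *: (('X_j0 : Pol2) ^+ (a + 1) * ('X_j0 + 'X_j1) ^+ (b - 3))) /\
      (* (4) *)
      (T 0%N = ('X_j0 + 'X_j1 : Pol2) ^+ (a + b - 1)) /\
      (* (5) *)
      ((3 <= a + b)%N ->
        T 1%N = (A - 1) *: (('X_j0 + 'X_j1 : Pol2) ^+ (a + b - 2))
                + (B - A) *: ('X_j0 * ('X_j0 + 'X_j1 : Pol2) ^+ (a + b - 3))) /\
      (* (6) *)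
      ((5 <= a + b)%N ->
        T 2%N = ((A - 1) * (A - 2) / 2) *: (('X_j0 + 'X_j1 : Pol2) ^+ (a + b - 3))
                + (A * (B - A) - A) *: ('X_j0 * ('X_j0 + 'X_j1 : Pol2) ^+ (a + b - 4))
                + (((B - A) ^+ 2 + 5 * A - 3 * B) / 2)
                    *: ('X_j0 ^+ 2 * ('X_j0 + 'X_j1 : Pol2) ^+ (a + b - 5))).

Proof.
move=> a0 ab co fam num PS PR PT A B.
have [c [f [C1 [C2 tr]]]] := numerator_unique _ _ _ _ a0 ab co fam num.
have b0 := leq_trans a0 ab; have ab0 : (0 < a + b)%N by lia.
set e := (b - a)%N in tr.
have Eae : (a + e = b)%N by rewrite /e; lia.
have EN : (2 * a + e = a + b)%N by lia.
have EB : B = A + e%:R by rewrite /B -Eae natrD.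
pose x : Pol2 := 'X_j0; pose y : Pol2 := 'X_j1; pose s := x + y.
have s0 : s != 0 := X0D1_neq0.
have halfE : (2^-1 : rat)%:MP + (2^-1)%:MP = 1 :> Pol2.
  by rewrite -mpolyCD -mpolyC1; congr (_%:MP).
(* The given expansions of [P] identify [S i], [R i], [T i] with coefficients of the substituted
   [P], the last two up to [s^(2i)]. *)
have coefS i : (i < a + b)%N -> (poly_subst 'X x%:P y%:P P)`_i = S i.
  move=> lti; rewrite PS (coef_poly_subst _ _ _ _ _ _ _ _ 1) ?expr1n ?mulr1 //.
  - exact: poly_substv.
  - exact: poly_substw.
  - by rewrite poly_substu polyC1 mul1r.
have coefR i : (i < a + b)%N ->
    (poly_subst x%:P ((s ^+ 2)%:P * 'X) y%:P P)`_i = R i * (s ^+ 2) ^+ i.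
  move=> lti; rewrite PR (coef_poly_subst _ _ _ _ _ _ _ _ (s ^+ 2)) //.
  - exact: poly_substu.
  - exact: poly_substw.
  - exact: poly_substv.
have coefT i : (i < a + b)%N ->
    (poly_subst x%:P y%:P ((s ^+ 2)%:P * 'X) P)`_i = T i * (s ^+ 2) ^+ i.
  move=> lti; rewrite PT (coef_poly_subst _ _ _ _ _ _ _ _ (s ^+ 2)) //.
  - exact: poly_substu.
  - exact: poly_substv.
  - exact: poly_substw.
have /= EqS := numerator_expand_u _ _ _ _ _ _ _ tr a0.
have /= [EqR0 EqR1] := numerator_expand_v _ _ _ _ _ _ _ tr a0.
have /= [EqT0 EqT1 EqT2] := numerator_expand_w _ _ _ _ _ _ _ tr a0 _ halfE.
move: EqS EqR0 EqR1 EqT0 EqT1 EqT2; rewrite -/x -/y -/s EN Eae.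
rewrite (coefS 0%N) // !(coefR 0%N) // !(coefT 0%N) //.
rewrite !expr0 !mulr1 => EqS EqR0 EqR1 EqT0 EqT1 EqT2.
have ratE : (A%:MP = a%:R :> Pol2) * (B%:MP = a%:R + e%:R :> Pol2).
  by rewrite EB mpolyCD /A !rmorph_nat.
split; [|split; [|split; [|split; [|split]]]].
- apply: (mulfI s0); rewrite EqS mulrCA -exprS.
  by congr (_ * _ ^+ _); lia.
- apply: (mulfI s0); rewrite EqR0 mulrCA -exprS mulrC.
  by congr (_ * _ ^+ _); lia.
- move=> b3; have lt1 : (1 < a + b)%N by lia.
  move: EqR0 (EqR1 (ltnW b3)); rewrite coefR // expr1.
  (* This turns the truncated exponents [b - 2], [b - 3] into [n + 1], [n]. *)
  have [n ->] : exists n, b = n.+3 by exists (b - 3)%N; lia.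
  move=> E0 E1; rewrite (solve_v _ _ _ _ _ _ _ _ _ s0 E0 E1).
  rewrite -!mul_mpolyC !(mpolyCB, mpolyCM, ratE, rmorph_nat, mpolyC1).
  rewrite !subSS !subn0 addn1 (exprSr x).
  move: (x ^+ a) (s ^+ n) (s ^+ n.+1) => X q q'.
  by ring.
- by apply: (mulfI s0); rewrite EqT0 -exprS; congr (_ ^+ _); lia.
- move=> N3; have lt1 : (1 < a + b)%N by lia.
  move: EqT0 (EqT1 N3); rewrite coefT // expr1.
  have [n ->] : exists n, (a + b = n.+3)%N by exists (a + b - 3)%N; lia.
  move=> E0 E1; rewrite (solve_w1 _ _ _ _ _ _ _ _ s0 E0 E1).
  rewrite -!mul_mpolyC !(mpolyCB, mpolyCM, ratE, rmorph_nat, mpolyC1).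
  rewrite !subSS !subn0 -/x -/y -/s.
  move: (s ^+ n) (s ^+ n.+1) => q q'.
  by ring.
- move=> N5; have lt1 : (1 < a + b)%N by lia.
  have lt2 : (2 < a + b)%N by lia.
  move: EqT0 (EqT1 lt2) (EqT2 N5); rewrite !coefT // expr1.
  have [n ->] : exists n, (a + b = n.+4.+1)%N by exists (a + b - 5)%N; lia.
  move=> E0 E1; have E1' := solve_w1 _ _ _ _ _ _ _ _ s0 E0 E1.
  move=> E2; rewrite (solve_w2 _ _ _ _ _ _ _ _ _ s0 halfE E1' E2).
  rewrite -!mul_mpolyC.
  rewrite !(mpolyCB, mpolyCD, mpolyCM, rmorphXn, ratE, rmorph_nat, mpolyC1) /=.
  rewrite !subSS !subn0 -/x -/y -/s.
  move: (2^-1)%:MP (s ^+ n) (s ^+ n.+1) (s ^+ n.+2) => k q q' q''.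
  by ring.
Qed.
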